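(* For all $n\ge 0$, $$h_n=\begin{cases} n!\,(n+2), & \text{if } n \text{ is odd},\\ (n+1)!, & \text{if } n\text{ is even},\end{cases}$$ and for all $n\ge 1$, $$\beta_n=\begin{cases} n+2, & \text{if } n \text{ is odd},\\ n, & \text{if } n\text{ is even}.\end{cases}$$
   Context: $\mathbb{H}$ denotes the real quaternions; $\Lambda\subset\mathbb{H}$ is the set of pure (imaginary) quaternions $z=x_1\mathbf i+x_2\mathbf j+x_3\mathbf k$, identified with $\mathbb{R}^3$. The measure on $\Lambda$ is $d\mu(z)=(2\pi)^{-3/2}e^{-|z|^2/2}\,dm(z)$, with $m$ Lebesgue measure on $\mathbb{R}^3$. Polynomials are functions on $\Lambda$ of the form $P(z)=\sum_{k=0}^N z^ka_k$, $a_k\in\mathbb{H}$, with scalar product $\langle u,w\rangle=\int_\Lambda \overline{u(z)}w(z)\,d\mu(z)$. $P_n$ ($n\ge0$) denotes the (unique) system of monic polynomials (leading term $z^n$) with $\langle P_k,P_l\rangle=0$ for $k\ne l$. $h_n:=\langle P_n,P_n\rangle$, and for $n\ge1$, $\beta_n=h_n/h_{n-1}$ is the coefficient in the three-term recurrence $P_{n+1}(z)=zP_n(z)+\beta_nP_{n-1}(z)$. *)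

(* Defs.v *)
From HB Require Import structures.
From mathcomp Require Import all_boot all_order all_algebra.
From mathcomp Require Import ring lra.
From mathcomp Require Import all_classical all_reals all_analysis.
From mathcomp Require Import measurable_realfun.

Set Implicit Arguments.
Unset Strict Implicit.
Unset Printing Implicit Defensive.

Import Order.TTheory GRing.Theory Num.Theory.

Local Open Scope classical_set_scope.
Local Open Scope ring_scope.

(* [Quat a b c d] is a + b i + c j + d k. *)
Record quat (R : Type) := Quat { qre : R; qi : R; qj : R; qk : R }.

Section QuatRing.
Context {R : realType}.
Implicit Types x y z : quat R.

Definition quat_tuple x := (qre x, qi x, qj x, qk x).
Definition tuple_quat (t : R * R * R * R) : quat R :=
  let: (a, b, c, d) := t in Quat a b c d.

Lemma quat_tupleK : cancel quat_tuple tuple_quat.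
Proof. by case. Qed.

HB.instance Definition _ := Choice.copy (quat R) (can_type quat_tupleK).

Definition addq x y :=
  Quat (qre x + qre y) (qi x + qi y) (qj x + qj y) (qk x + qk y).
Definition oppq x := Quat (- qre x) (- qi x) (- qj x) (- qk x).
Definition mulq x y := Quat
  (qre x * qre y - qi x * qi y - qj x * qj y - qk x * qk y)
  (qre x * qi y + qi x * qre y + qj x * qk y - qk x * qj y)
  (qre x * qj y - qi x * qk y + qj x * qre y + qk x * qi y)
  (qre x * qk y + qi x * qj y - qj x * qi y + qk x * qre y).

Lemma addqA : associative addq.
Proof. by move=> [????] [????] [????]; rewrite /addq /= !addrA. Qed.
Lemma addqC : commutative addq.
Proof. by move=> [????] [????]; rewrite /addq /=; congr Quat; exact: addrC. Qed.
Lemma add0q : left_id (Quat 0 0 0 0) addq.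
Proof. by move=> [????]; rewrite /addq /= !add0r. Qed.
Lemma addNq : left_inverse (Quat 0 0 0 0) oppq addq.
Proof. by move=> [????]; rewrite /addq /= !addNr. Qed.

HB.instance Definition _ := GRing.isZmodule.Build (quat R)
  addqA addqC add0q addNq.

Lemma mulqA : associative mulq.
Proof.
by move=> [????] [????] [????]; rewrite /mulq; congr Quat => /=; ring.
Qed.
Lemma mul1q : left_id (Quat 1 0 0 0) mulq.
Proof. by move=> [????]; rewrite /mulq; congr Quat => /=; ring. Qed.
Lemma mulq1 : right_id (Quat 1 0 0 0) mulq.
Proof. by move=> [????]; rewrite /mulq; congr Quat => /=; ring. Qed.
Lemma mulqDl : left_distributive mulq +%R.
Proof.
by move=> [????] [????] [????]; rewrite /mulq; congr Quat => /=; ring.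
Qed.
Lemma mulqDr : right_distributive mulq +%R.
Proof.
by move=> [????] [????] [????]; rewrite /mulq; congr Quat => /=; ring.
Qed.
Lemma oneq_neq0 : Quat 1 0 0 0 != 0 :> quat R.
Proof. by apply/eqP => -[/eqP]; rewrite oner_eq0. Qed.

HB.instance Definition _ := GRing.Zmodule_isNzRing.Build (quat R)
  mulqA mul1q mulq1 mulqDl mulqDr oneq_neq0.

Definition conjq x := Quat (qre x) (- qi x) (- qj x) (- qk x).

Definition sqnormq x := qre x ^+ 2 + qi x ^+ 2 + qj x ^+ 2 + qk x ^+ 2.
Definition normq x := Num.sqrt (sqnormq x).

Definition invq x := Quat (qre x / sqnormq x) (- qi x / sqnormq x)
  (- qj x / sqnormq x) (- qk x / sqnormq x).

Lemma sqnormq_eq0 x : (sqnormq x == 0) = (x == 0).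
Proof.
apply/eqP/eqP => [|->]; last by rewrite /sqnormq /= expr0n /= !addr0.
case: x => a b c d; rewrite /sqnormq /= => /eqP.
rewrite !paddr_eq0 ?addr_ge0 ?sqr_ge0// !sqrf_eq0.
by move=> /andP[/andP[/andP[/eqP-> /eqP->] /eqP->] /eqP->].
Qed.

Lemma mulVq : {in [pred x | x != 0], left_inverse 1 invq *%R}.
Proof.
move=> x; rewrite inE -sqnormq_eq0 ; case: x => a b c d.
rewrite /sqnormq /= => x0; rewrite -[RHS]/(Quat 1 0 0 0).
by congr Quat => /=; rewrite /sqnormq /=; field.
Qed.
Lemma mulqV : {in [pred x | x != 0], right_inverse 1 invq *%R}.
Proof.
move=> x; rewrite inE -sqnormq_eq0 ; case: x => a b c d.
rewrite /sqnormq /= => x0; rewrite -[RHS]/(Quat 1 0 0 0).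
by congr Quat => /=; rewrite /sqnormq /=; field.
Qed.
Lemma unitqP x y : y * x = 1 /\ x * y = 1 -> [pred x | x != 0] x.
Proof.
move=> [yx _] /=; apply/eqP => x0; move: yx; rewrite x0 mulr0 => /eqP.
by rewrite eq_sym oner_eq0.
Qed.
Lemma invq_out : {in [predC [pred x : quat R | x != 0]], invq =1 id}.
Proof.
move=> x; rewrite !inE negbK => /eqP ->.
by rewrite /invq /= oppr0 !mul0r.
Qed.

HB.instance Definition _ := GRing.NzRing_hasMulInverse.Build (quat R)
  mulVq mulqV unitqP invq_out.

End QuatRing.

(* The space of pure quaternions, in coordinates (x1, x2, x3), with the product
   Borel sigma-algebra of R^3. *)
Notation pureq R :=
  (measurableTypeR R * measurableTypeR R * measurableTypeR R)%type.

Section GaussianMeasure.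
Context {R : realType}.

Definition quat_of_pure (z : pureq R) : quat R := Quat 0 z.1.1 z.1.2 z.2.

Definition lebesgue3 : {measure set (pureq R) -> \bar R} :=
  ((lebesgue_measure \x lebesgue_measure) \x lebesgue_measure)%E.

Definition gauss3_pdf (z : pureq R) : R :=
  (2 * pi) `^ (- (3 / 2)) * expR (- normq (quat_of_pure z) ^+ 2 / 2).

Definition gauss3 (A : set (pureq R)) : \bar R :=
  (\int[lebesgue3]_(z in A) (gauss3_pdf z)%:E)%E.

Lemma gauss3_pdf_ge0 z : 0 <= gauss3_pdf z.
Proof. by rewrite mulr_ge0 ?powR_ge0 ?expR_ge0. Qed.

Lemma measurable_gauss3_pdf : measurable_fun [set: pureq R] gauss3_pdf.
Proof.
have -> : gauss3_pdf = fun z : pureq R => (2 * pi) `^ (- (3 / 2)) *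
    expR (- (z.1.1 ^+ 2 + z.1.2 ^+ 2 + z.2 ^+ 2) / 2).
  apply/funext => z; rewrite /gauss3_pdf /normq sqr_sqrtr.
    by rewrite /sqnormq /= expr0n /= add0r.
  by rewrite /sqnormq !addr_ge0 ?sqr_ge0.
have m11 : measurable_fun [set: pureq R] (fun z : pureq R => z.1.1).
  exact: (measurableT_comp measurable_fst measurable_fst).
have m12 : measurable_fun [set: pureq R] (fun z : pureq R => z.1.2).
  exact: (measurableT_comp measurable_snd measurable_fst).
have m2 : measurable_fun [set: pureq R] (fun z : pureq R => z.2).
  exact: measurable_snd.
apply: measurable_funM => //; apply: measurableT_comp => //.
apply: measurable_funM => //; apply: measurableT_comp => //.
apply: measurable_funD; last exact: measurable_funX.
by apply: measurable_funD; exact: measurable_funX.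
Qed.

Let gauss30 : gauss3 set0 = 0%E.
Proof. by rewrite /gauss3 integral_set0. Qed.

Let gauss3_ge0 A : (0 <= gauss3 A)%E.
Proof. by apply: integral_ge0 => z _; rewrite lee_fin gauss3_pdf_ge0. Qed.

Let gauss3_sigma_additive : semi_sigma_additive gauss3.
Proof.
move=> /= F mF tF mUF; rewrite /gauss3 ge0_integral_bigcup//=.
- apply: is_cvg_ereal_nneg_natsum_cond => n _ _.
  by apply: integral_ge0 => z _; rewrite lee_fin gauss3_pdf_ge0.
- apply/measurable_EFinP; apply: (measurable_funS measurableT) => //.
  exact: measurable_gauss3_pdf.
- by move=> z _; rewrite lee_fin gauss3_pdf_ge0.
Qed.

HB.instance Definition _ := isMeasure.Build _ _ _
  gauss3 gauss30 gauss3_ge0 gauss3_sigma_additive.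

End GaussianMeasure.

Section OrthogonalPolynomials.
Context {R : realType}.
Implicit Types u w : pureq R -> quat R.

(* Integral of a quaternion-valued function, component by component. *)
Definition qintegral u : quat R := Quat
  (\int[gauss3]_z qre (u z)) (\int[gauss3]_z qi (u z))
  (\int[gauss3]_z qj (u z)) (\int[gauss3]_z qk (u z)).

Definition qdot u w : quat R := qintegral (fun z => conjq (u z) * w z).

(* Coefficients stand to the right of the powers of z, so this is not
   the evaluation [_.[_]] of {poly quat R}. *)
Definition monic_poly (n : nat) u := exists a : nat -> quat R,
  forall z, u z = quat_of_pure z ^+ n + \sum_(k < n) quat_of_pure z ^+ k * a k.

Definition monic_orthogonal (P : nat -> pureq R -> quat R) :=
  (forall n, monic_poly n (P n)) /\
  (forall k l, k != l -> qdot (P k) (P l) = 0).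

Definition hcoef (P : nat -> pureq R -> quat R) n : quat R :=
  qdot (P n) (P n).

Definition betacoef (P : nat -> pureq R -> quat R) n : quat R :=
  hcoef P n / hcoef P n.-1.

End OrthogonalPolynomials.

(* Main.v *)
Require Import Defs.
From HB Require Import structures.
From mathcomp Require Import all_boot all_order all_algebra.
From mathcomp Require Import ring lra.
From mathcomp Require Import all_classical all_reals all_analysis.
From mathcomp Require Import measurable_realfun.

(* Since conj z = - z and z^2 = - |z|^2, the scalar product of z^k and z^l is
   (-1)^k m_(k+l), where m_n is real, m_n = 0 for n odd and
   m_(2j) = (-1)^j E|z|^(2j) = (-1)^j (2j+1)!!.  These are, up to the substitution
   z = i x, the moments of the weight x^2 e^(-x^2/2) on the line, so the P_n are
   generalized Hermite polynomials.  If Q_n is defined by the expected recurrence,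
   the integral of z^k Q_n is obtained by applying -D to x^k n times and taking the
   moment, where D is the Dunkl operator D x^k = k x^(k-1) for k even,
   D x^k = (k+2) x^(k-1) for k odd.  It vanishes for k < n, and for k = n it is
   (-1)^n times the product of the beta_j.  As P_n annihilates the powers below n,
   <P_n, P_n> = <P_n, z^n> = <P_n, Q_n> = (-1)^n E[z^n Q_n]. *)

Set Implicit Arguments.
Unset Strict Implicit.
Unset Printing Implicit Defensive.

Import Order.TTheory GRing.Theory Num.Theory.
Import numFieldNormedType.Exports.

Local Open Scope classical_set_scope.
Local Open Scope ring_scope.

(** * Moments of the standard Gaussian on the line *)

Fixpoint moment k : nat :=
  match k with 0 => 1%N | 1 => 0%N | k'.+2 => (k'.+1 * moment k')%N end.

Section GaussianMoments1D.
Context {R : realType}.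
Implicit Types x : R.
Local Notation mu := (@lebesgue_measure R).

Definition gauss1 x : R := (Num.sqrt (2 * pi))^-1 * expR (- x ^+ 2 / 2).

Lemma gauss1_ge0 x : 0 <= gauss1 x.
Proof. by rewrite mulr_ge0 ?invr_ge0 ?sqrtr_ge0 ?expR_ge0. Qed.

Lemma gauss1E : gauss1 = normal_pdf 0 1.
Proof.
apply/funext => x; rewrite normal_pdfE ?oner_neq0//.
rewrite /gauss1 /normal_peak /normal_fun subr0 expr1n mul1r.
by rewrite -(mulr_natl pi) .
Qed.

Lemma is_derive_gauss1 x : is_derive x 1 gauss1 (- x * gauss1 x).
Proof.
rewrite /gauss1; apply: is_derive_eq.
rewrite /GRing.scale /= /GRing.scale /=; field.
by rewrite gt_eqF// sqrtr_gt0 mulr_gt0// pi_gt0.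
Qed.

(** After passing to even powers, the exponential series at x^2/4 dominates each of its terms. The
    rate 1/4 uses up only half of the decay of [gauss1]. *)
Lemma normr_exprn_le k x : `|x| ^+ k <= (1 + 4 ^+ k * k`!%:R) * expR (x ^+ 2 / 4).
Proof.
have e1 : 1 <= expR (x ^+ 2 / 4) :> R.
  by rewrite -expR0 ler_expR divr_ge0 ?sqr_ge0.
have h : `|x| ^+ k <= 1 + (x ^+ 2) ^+ k.
  rewrite -(real_normK (num_real x)) -exprM mulnC exprM.
  have := sqr_ge0 (`|x| ^+ k - 1); have : 0 <= `|x| ^+ k by rewrite exprn_ge0.
  nra.
apply: (le_trans h).
have -> : (x ^+ 2) ^+ k = 4 ^+ k * (x ^+ 2 / 4) ^+ k.
  by rewrite -exprMn; congr (_ ^+ _); field.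
rewrite mulrDl mul1r lerD// -mulrA ler_wpM2l ?exprn_ge0//.
case: k h => [|k] _; first by rewrite fact0 mul1r expr0.
have := @expR_ge1Dxn R (x ^+ 2 / 4) k (divr_ge0 (sqr_ge0 _) (ler0n _ _)).
rewrite -ler_pdivrMl ?ltr0n ?fact_gt0// mulrC => /(le_trans _); apply.
by rewrite lerDr.
Qed.

(** Half of the exponent -x^2/2 absorbs the power; the other half is, up to a constant, the normal
    density of variance 2. The bound yields both integrability and decay at infinity. *)
Lemma normr_exprn_gauss1_le k : exists C : R, forall x,
  `|x ^+ k * gauss1 x| <= C * normal_pdf 0 (Num.sqrt 2) x.
Proof.
have pik : 0 < Num.sqrt (2 * pi) :> R by rewrite sqrtr_gt0 mulr_gt0 ?pi_gt0.
have s2 : Num.sqrt 2 != 0 :> R by rewrite sqrtr_eq0 -ltNge.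
have pe := normal_peak_gt0 s2.
exists ((Num.sqrt (2 * pi))^-1 * (1 + 4 ^+ k * k`!%:R) /
  normal_peak (Num.sqrt 2)) => x.
rewrite normrM normrX (ger0_norm (gauss1_ge0 x)) normal_pdfE// /normal_fun subr0.
rewrite sqr_sqrtr// [leRHS]mulrA divfK ?gt_eqF// /gauss1.
have -> : - x ^+ 2 / 2 = - x ^+ 2 / (2 *+ 2) - x ^+ 2 / 4 by field.
have h : `|x| ^+ k / expR (x ^+ 2 / 4) <= 1 + 4 ^+ k * k`!%:R.
  by rewrite ler_pdivrMr ?expR_gt0// normr_exprn_le.
rewrite expRD expRN.
rewrite [leLHS](_ : _ = (Num.sqrt (2 * pi))^-1 *
  (`|x| ^+ k / expR (x ^+ 2 / 4)) * expR (- x ^+ 2 / (2 *+ 2))); last by ring.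
by rewrite ler_pM2r ?expR_gt0// ler_pM2l// invr_gt0.
Qed.

Lemma measurable_gauss1 : measurable_fun [set: R] gauss1.
Proof. by rewrite gauss1E; exact: measurable_normal_pdf. Qed.

Lemma continuous_gauss1 : continuous gauss1.
Proof. by rewrite gauss1E; apply: continuous_normal_pdf; rewrite oner_eq0. Qed.

Lemma integrable_moment k :
  mu.-integrable setT (fun x => (x ^+ k * gauss1 x)%:E).
Proof.
have [C hC] := normr_exprn_gauss1_le k.
refine (@le_integrable _ _ _ mu setT measurableT _
  (fun x => (C%:E * (normal_pdf 0 (Num.sqrt 2) x)%:E)%E) _ _ _).
- apply/measurable_EFinP; apply: measurable_funM => //.
  exact: measurable_gauss1.
- by move=> x _; rewrite -EFinM !abse_EFin lee_fin (le_trans (hC x))// ler_norm.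
- apply: integrableZl => //; exact: integrable_normal_pdf.
Qed.

(* The derivative [dFk k] of [Fk k] has integral 0, which relates the moments of
   orders [k + 1] and [k - 1]. *)
Let Fk k x := x ^+ k * gauss1 x.
Let dFk k x := k%:R * (x ^+ k.-1 * gauss1 x) - x ^+ k.+1 * gauss1 x.

Let is_derive_Fk k x : is_derive x 1 (Fk k) (dFk k x).
Proof.
have := is_derive_gauss1 x => h.
have -> : Fk k = (@id R) ^+ k * gauss1.
  by apply/funext => y; rewrite exprfctE.
apply: is_derive_eq; rewrite /dFk /GRing.scale /= exprfctE exprS; ring.
Qed.

Let integrable_dFk k : mu.-integrable setT (EFin \o dFk k).
Proof.
rewrite (_ : EFin \o _ = (fun x => k%:R%:E * (x ^+ k.-1 * gauss1 x)%:E)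
   \- (fun x => (x ^+ k.+1 * gauss1 x)%:E))%E; last first.
  by apply/funext => x; rewrite /= EFinB EFinM.
apply: integrableB => //; last exact: integrable_moment.
by apply: integrableZl => //; exact: integrable_moment.
Qed.

Let continuous_dFk k : continuous (dFk k).
Proof.
move=> x; apply: cvgB.
  apply: cvgM; first exact: cvg_cst.
  apply: cvgM; [exact: exprn_continuous|exact: continuous_gauss1].
apply: cvgM; [exact: exprn_continuous|exact: continuous_gauss1].
Qed.

(** The radius [n.+1] keeps the interval nondegenerate for the fundamental theorem of calculus, and
    its end points nonzero for [cvg_Fk]. *)
Let integral_itv_dFk k (n : nat) :
  (\int[mu]_(x in `[(- n.+1%:R)%R, n.+1%:R%R]) (dFk k x)%:E =
    (Fk k n.+1%:R - Fk k (- n.+1%:R))%R%:E)%E.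
Proof.
have dF x : derivable (Fk k) x 1 by apply: ex_derive; apply: is_derive_Fk.
have cF x : continuous_at x (Fk k).
  by apply: differentiable_continuous; apply/derivable1_diffP.
rewrite (@continuous_FTC2 _ _ (Fk k)) ?EFinB//.
- by rewrite (@lt_trans _ _ 0) ?oppr_lt0.
- exact/continuous_subspaceT/continuous_dFk.
- split=> [x _//||]; last exact/cvg_at_left_filter/cF.
  exact/cvg_at_right_filter/cF.
- by move=> x _; rewrite derive1E; apply: derive_val.
Qed.

Let cvg_Fk k : Fk k n.+1%:R - Fk k (- n.+1%:R) @[n --> \oo] --> (0 : R).
Proof.
have [C hC] := normr_exprn_gauss1_le k.+1.
have s2 : Num.sqrt 2 != 0 :> R by rewrite sqrtr_eq0 -ltNge.
(* Dividing the bound for the exponent [k.+1] by |x| gives decay of order 1/|x|, since a normal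
   density is bounded by its peak. *)
have [D FD] : exists D, forall x, x != 0 -> `|Fk k x| <= D * `|x|^-1.
  exists (`|C| * normal_peak (Num.sqrt 2)) => x x0.
  rewrite ler_pdivlMr ?normr_gt0// -normrM.
  rewrite /Fk mulrC mulrA -exprS (le_trans (hC x))//.
  rewrite (le_trans (ler_norm _))// normrM ler_wpM2l//.
  by rewrite ger0_norm ?normal_pdf_ge0// normal_pdf_ub.
apply/cvgr0Pnorm_le => //.
have h : (D * 2) * (n.+1%:R)^-1 @[n --> \oo] --> (0 : R).
  rewrite -[X in _ --> X](mulr0 (D * 2)).
  apply: cvgM; [exact: cvg_cst|exact: cvg_harmonic].
move=> e e0; move/cvgr0Pnorm_le : h => /(_ _ e0); apply: filterS => n.
have nn : `|n.+1%:R : R| = n.+1%:R by rewrite ger0_norm.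
apply: le_trans.
rewrite (le_trans (ler_normB _ _))//.
rewrite (le_trans (lerD (FD _ _) (FD _ _))) ?oppr_eq0 ?pnatr_eq0//.
rewrite normrN !nn (le_trans _ (ler_norm _))//.
by rewrite [D * 2]mulrC -mulrA mulr_natl mulr2n.
Qed.

(** The boundary terms on growing symmetric intervals tend to 0; dominated convergence, with
    |[dFk k]| as majorant, identifies their limit with the integral over the line. *)
Let integral_dFk k : (\int[mu]_x (dFk k x)%:E = 0)%E.
Proof.
pose I n := `[- n.+1%:R, n.+1%:R]%classic : set R.
pose f_ n := (EFin \o dFk k) \_ (I n).
have mdF : measurable_fun setT (EFin \o dFk k).
  by apply: measurable_int (integrable_dFk k).
have mf n : measurable_fun setT (f_ n).
  have mI : measurable (I n) by exact: measurable_itv.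
  exact: (measurable_restrictT (EFin \o dFk k) mI).1 (measurable_funTS mdF).
have cf : {ae mu, forall x, setT x -> f_ ^~ x @ \oo --> (EFin \o dFk k) x}.
  apply: aeW => x _; apply: cvg_near_cst; exists (Num.truncn `|x|) => // m /= xm.
  rewrite /f_ patchE ifT// inE /I /= in_itv/= -ler_norml.
  by rewrite ltW// (lt_le_trans (truncnS_gt _))// ler_nat.
have bf : {ae mu, forall x n, setT x ->
    (`|f_ n x| <= (abse \o (EFin \o dFk k)) x)%E}.
  apply: aeW => x m _; rewrite /f_ patchE.
  by case: ifPn => //= _; rewrite normr0 lee_fin.
have [_ _ h] := @dominated_convergence _ _ _ mu setT measurableT f_
  (EFin \o dFk k) (abse \o (EFin \o dFk k)) mf mdF cf
  (integrable_abse (integrable_dFk k)) bf.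
have hE : [sequence (\int[mu]_x f_ n x)%E]_n =
    EFin \o (fun n => Fk k n.+1%:R - Fk k (- n.+1%:R)).
  by apply/funext => n /=; rewrite -integral_mkcond integral_itv_dFk.
rewrite hE in h.
apply: (cvg_unique (@ereal_hausdorff R) h).
by apply: cvg_EFin; [exact: nearW|exact: cvg_Fk].
Qed.

Lemma integral_moment k :
  (\int[mu]_x (x ^+ k * gauss1 x)%:E = (moment k)%:R%:E)%E.
Proof.
have fin j : (\int[mu]_x (x ^+ j * gauss1 x)%:E)%E \is a fin_num.
  exact/integrable_fin_num/integrable_moment.
(* This is the vanishing of the integral of [dFk j]. For [j = 0] the truncated predecessor is
   harmless, as its coefficient is 0. *)
have step j : (\int[mu]_x (x ^+ j.+1 * gauss1 x)%:E =
    j%:R%:E * \int[mu]_x (x ^+ j.-1 * gauss1 x)%:E)%E.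
  have := integral_dFk j; under eq_integral do rewrite EFinB EFinM.
  rewrite integralB//; last 2 first.
  - by apply: integrableZl => //; exact: integrable_moment.
  - exact: integrable_moment.
  rewrite integralZl//; last exact: integrable_moment.
  move/eqP; rewrite sube_eq.
  - by rewrite add0e => /eqP.
  - by rewrite fin_numM.
  - by apply: fin_num_adde_defl.
have [n kn] := ubnP k; elim: n k kn => // n IH [|[|k]] kn.
- under eq_integral do rewrite expr0 mul1r gauss1E.
  exact: integral_normal_pdf.
- by rewrite step mul0e.
- rewrite step [k.+1.-1]/= IH; last by rewrite -ltnS (ltn_trans _ kn).
  by rewrite -EFinM -natrM.
Qed.

End GaussianMoments1D.

(** * Integration against a measure given by a density *)

Section Density.
Context d (T : measurableType d) (R : realType).
Variables (mu nu : {measure set T -> \bar R}) (g : T -> R).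
Hypothesis g0 : forall x, 0 <= g x.
Hypothesis mg : measurable_fun setT g.
Hypothesis nuE : forall A, measurable A -> nu A = (\int[mu]_(x in A) (g x)%:E)%E.

Import HBNNSimple.

(** Monotone convergence along increasing simple functions, applied on both sides, reduces the claim
    to indicators, where it is [nuE]. *)
Lemma ge0_integral_density (f : T -> \bar R) : (forall x, 0 <= f x)%E ->
  measurable_fun setT f ->
  (\int[nu]_x f x = \int[mu]_x (f x * (g x)%:E))%E.
Proof.
move=> f0 mf.
have mge : measurable_fun setT (EFin \o g) by exact/measurable_EFinP.
pose h := nnsfun_approx measurableT mf.
have hf x : (EFin \o h n) x @[n --> \oo] --> f x.
  exact: cvg_nnsfun_approx.
have ndh x : {homo (fun n => (EFin \o h n) x) : a b / (a <= b)%N >-> (a <= b)%E}.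
  by move=> a b ab; rewrite lee_fin; exact/lefP/nd_nnsfun_approx.
have -> : (\int[nu]_x f x = lim (\int[nu]_x (EFin \o h n) x @[n --> \oo]))%E.
  under eq_integral => x _ do rewrite -(cvg_lim _ (hf x))//.
  apply: monotone_convergence => //.
  - by move=> n; apply/measurable_EFinP/measurable_funP.
  - by move=> n x _ /=; rewrite lee_fin.
have -> : (\int[mu]_x (f x * (g x)%:E) =
    lim (\int[mu]_x ((EFin \o h n) x * (g x)%:E) @[n --> \oo]))%E.
  have fg x : ((EFin \o h n) x * (g x)%:E)%E @[n --> \oo] --> (f x * (g x)%:E)%E.
    by apply: cvgeZr => //; exact: hf.
  under eq_integral => x _ do rewrite -(cvg_lim _ (fg x))//.
  apply: monotone_convergence => //.
  - move=> n; apply: emeasurable_funM => //.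
    by apply/measurable_EFinP/measurable_funP.
  - by move=> n x _ /=; rewrite mule_ge0 ?lee_fin.
  - by move=> x _ a b ab; rewrite lee_wpmul2r ?lee_fin ?g0//; exact: ndh.
congr (lim (_ @ \oo)); apply/funext => n /=.
transitivity (\int[nu]_x
   (\sum_(y \in range (h n)) (y * \1_(h n @^-1` [set y]) x)%:E))%E.
  by apply: eq_integral => t _; rewrite /= fimfunE -fsumEFin.
have indich r : measurable_fun setT (fun x => (r * \1_(h n @^-1` [set r]) x)%:E).
  by apply/measurable_EFinP; exact: measurable_funM.
rewrite ge0_integral_fsum//; last by move=> m y _; exact: nnfun_muleindic_ge0.
transitivity (\int[mu]_x (\sum_(y \in range (h n))
    (y * \1_(h n @^-1` [set y]) x)%:E * (g x)%:E))%E; last first.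
  apply: eq_integral => x _.
  rewrite -ge0_mule_fsuml => [|y]; last exact: nnfun_muleindic_ge0.
  by rewrite fsumEFin // -(fimfunE _ x).
rewrite ge0_integral_fsum//; last 2 first.
  - by move=> y; apply: emeasurable_funM.
  - move=> m y _; apply: mule_ge0; last by rewrite lee_fin.
    exact: nnfun_muleindic_ge0.
(* Both terms are [r] times the [nu]-measure of the level set of [h n] at [r]; the sign of [r] comes
   from its being a value of [h n]. *)
apply: eq_fsbigr => r rhn.
under eq_integral do rewrite EFinM.
rewrite integralZl_indic_nnsfun => //.
under [RHS]eq_integral do rewrite EFinM -muleA.
rewrite ge0_integralZl//.
- under [in RHS]eq_integral do rewrite muleC.
  rewrite [in RHS](eq_integral ((EFin \o g) \_ (h n @^-1` [set r]))); last first.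
    by move=> x xE; rewrite epatch_indic.
  by rewrite -integral_mkcondr setTI -nuE// integral_indic// setIT.
- by apply: emeasurable_funM => //; exact/measurable_EFinP.
- by move=> t _; rewrite mule_ge0 ?lee_fin.
- by move: rhn; rewrite inE => -[t _ <-]; rewrite lee_fin.
Qed.

(** The nonnegative case applied to |f| gives integrability; applied to the positive and negative
    parts, which commute with multiplication by [g] as [g] is nonnegative, it gives the value. *)
Lemma integral_density (f : T -> R) : measurable_fun setT f ->
  mu.-integrable setT (fun x => (f x * g x)%:E) ->
  nu.-integrable setT (EFin \o f) /\
  (\int[nu]_x (f x)%:E = \int[mu]_x (f x * g x)%:E)%E.
Proof.
move=> mf ifg.
have mfe : measurable_fun setT (EFin \o f) by exact/measurable_EFinP.
split.
  apply/integrableP; split => //.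
  rewrite ge0_integral_density//; last exact: measurableT_comp.
  move/integrableP : ifg => [_]; apply: le_lt_trans; apply: ge0_le_integral => //.
  - by move=> x _; rewrite mule_ge0 ?lee_fin.
  - apply: emeasurable_funM; first exact: measurableT_comp.
    exact/measurable_EFinP.
  - apply: measurableT_comp => //; apply/measurable_EFinP.
    exact: measurable_funM.
  - by move=> x _; rewrite /= normrM EFinM (ger0_norm (g0 x)).
rewrite integralE [RHS]integralE; congr (_ - _)%E.
- rewrite ge0_integral_density//; last exact: measurable_funepos.
  apply: eq_integral => x _; rewrite !funeposE -!EFin_max -EFinM.
  by rewrite maxr_pMl// mul0r.
- rewrite ge0_integral_density//; last exact: measurable_funeneg.
  apply: eq_integral => x _; rewrite !funenegE -!EFinN -!EFin_max -EFinM.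
  by rewrite maxr_pMl// mul0r mulNr.
Qed.

End Density.

(** * Integrals of products of functions of separate variables *)

Section ProductIntegral.
Context d1 d2 (T1 : measurableType d1) (T2 : measurableType d2) (R : realType).
Variables (m1 : {sigma_finite_measure set T1 -> \bar R}).
Variables (m2 : {sigma_finite_measure set T2 -> \bar R}).

(* The library's sigma-finite structure on [m1 \x m2] is not found by canonical
   inference: the one on products of subprobabilities has the same key. *)
Definition sigma_finite_prod : set (T1 * T2) -> \bar R := (m1 \x m2)%E.

HB.instance Definition _ := Measure.on sigma_finite_prod.
HB.instance Definition _ := Measure_isSigmaFinite.Build _ _ _ sigma_finite_prod
  (lebesgue_integral_fubini.product_measure_sigma_finite_subproof m1 m2).

Variables (f : T1 -> R) (g : T2 -> R).
Hypothesis intf : m1.-integrable setT (EFin \o f).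
Hypothesis intg : m2.-integrable setT (EFin \o g).

(** By Tonelli it suffices that the iterated integral of the absolute value is finite, and it is a
    product of two finite integrals. *)
Lemma integrable_prod :
  (m1 \x m2)%E.-integrable setT (fun z => (f z.1 * g z.2)%:E).
Proof.
have mf : measurable_fun setT f.
  by apply/measurable_EFinP; exact: measurable_int intf.
have mg : measurable_fun setT g.
  by apply/measurable_EFinP; exact: measurable_int intg.
apply/integrable12ltyP.
  apply/measurable_EFinP; apply: measurable_funM.
    exact: (measurableT_comp mf measurable_fst).
  exact: (measurableT_comp mg measurable_snd).
under eq_integral => x _.
  under eq_integral do rewrite /= normrM EFinM.
  rewrite ge0_integralZl//; last exact/measurable_EFinP/measurableT_comp.
  over.
rewrite /=.
have intg' := integrable_abse intg.
rewrite ge0_integralZr//.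
- move/integrableP : intf => [_ If]; move/integrableP : intg => [_ Ig].
  rewrite lte_mul_pinfty//.
  + exact: integral_ge0.
  + by rewrite ge0_fin_numE//; exact: integral_ge0.
- exact/measurable_EFinP/measurableT_comp.
- exact: integral_ge0.
Qed.

Lemma integral_prod : (\int[m1 \x m2]_z (f z.1 * g z.2)%:E =
  (\int[m1]_x (f x)%:E) * (\int[m2]_y (g y)%:E))%E.
Proof.
rewrite -(integral12_prod_meas1 integrable_prod) /fubini_F /=.
under eq_integral => x _.
  under eq_integral do rewrite EFinM.
  rewrite integralZl//; over.
have fg : (\int[m2]_y (g y)%:E)%E \is a fin_num by exact: integrable_fin_num.
by rewrite /= -(fineK fg) integralZr.
Qed.

End ProductIntegral.

(** * Double factorials and their Vandermonde identity *)

(** The rising factorial of step 2, a (a+2) ... (a+2m-2): [rising2 1 m] is (2m-1)!! and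
    [rising2 3 m] is (2m+1)!!. *)
Fixpoint rising2 a m : nat :=
  if m is m'.+1 then (rising2 a m' * (a + m'.*2))%N else 1%N.

Lemma rising2S a m : rising2 a m.+1 = (rising2 a m * (a + m.*2))%N.
Proof. by []. Qed.

Arguments rising2 : simpl never.

Lemma momentSS k : moment k.+2 = (k.+1 * moment k)%N.
Proof. by []. Qed.

Lemma moment_even m : moment m.*2 = rising2 1 m.
Proof.
by elim: m => // m IH; rewrite doubleS momentSS IH mulnC rising2S add1n.
Qed.

Lemma moment_odd m : moment m.*2.+1 = 0%N.
Proof. by elim: m => // m IH; rewrite doubleS momentSS IH muln0. Qed.

(** Induction on [m]: the new factor a+b+2m splits as (a+2(m-i)) + (b+2i), and each summand
    lengthens one of the two rising factorials. It lets the coordinates of the squared norm be added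
    one at a time. *)
Lemma rising2_Vandermonde a b m :
  (\sum_(i < m.+1) 'C(m, i) * (rising2 a (m - i) * rising2 b i))%N =
  rising2 (a + b) m.
Proof.
elim: m => [|m IH]; first by rewrite big_ord1.
rewrite rising2S -IH big_distrl /=.
under [RHS]eq_bigr => i _.
  have -> : (a + b + m.*2 = (a + (m - i).*2) + (b + i.*2))%N.
    by rewrite addnACA -doubleD subnK// -ltnS.
  rewrite mulnDr.
  have -> : ('C(m, i) * (rising2 a (m - i) * rising2 b i) * (a + (m - i).*2) =
     'C(m, i) * (rising2 a (m - i).+1 * rising2 b i))%N.
    by rewrite rising2S; ring.
  have -> : ('C(m, i) * (rising2 a (m - i) * rising2 b i) * (b + i.*2) =
     'C(m, i) * (rising2 a (m - i) * rising2 b i.+1))%N.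
    by rewrite rising2S; ring.
  over.
rewrite big_split /= big_ord_recl bin0 subn0.
(* Pascal's rule splits the left side into the same two sums; the overflow term has binomial
   coefficient C(m, m+1) = 0. *)
under [in LHS]eq_bigr => i _ do rewrite lift0 binS subSS mulnDl.
rewrite big_split /= addnA; congr (_ + _)%N.
rewrite [RHS]big_ord_recl bin0 subn0; congr (_ + _)%N.
rewrite big_ord_recr /= bin_small// mul0n addn0.
by apply: eq_bigr => i _; rewrite /bump leq0n add1n subnSK.
Qed.

(** * Gaussian expectations on R^3 *)

Section GaussianExpectation.
Context {R : realType}.
Implicit Types (f g : pureq R -> R) (z : pureq R).

Definition sqnorm3 z : R := z.1.1 ^+ 2 + z.1.2 ^+ 2 + z.2 ^+ 2.

Lemma sqnormq_pure z : sqnormq (quat_of_pure z) = sqnorm3 z.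
Proof. by rewrite /sqnormq /= expr0n add0r. Qed.

Lemma gauss3_pdfE z :
  gauss3_pdf z = gauss1 z.1.1 * gauss1 z.1.2 * gauss1 z.2.
Proof.
have pi2 : 0 <= 2 * pi :> R by rewrite mulr_ge0 ?pi_ge0.
rewrite /gauss3_pdf /normq sqr_sqrtr; last first.
  by rewrite sqnormq_pure !addr_ge0 ?sqr_ge0.
rewrite sqnormq_pure /sqnorm3 /gauss1.
have -> : (2 * pi) `^ (- (3 / 2)) = (Num.sqrt (2 * pi))^-1 ^+ 3 :> R.
  rewrite powRN -powR12_sqrt// exprVn -powR_mulrn ?powR_ge0//.
  by rewrite -powRrM [3 / 2]mulrC.
have -> : - (z.1.1 ^+ 2 + z.1.2 ^+ 2 + z.2 ^+ 2) / 2 =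
  - z.1.1 ^+ 2 / 2 + - z.1.2 ^+ 2 / 2 + - z.2 ^+ 2 / 2 :> R by field.
by rewrite !expRD; ring.
Qed.

(** Integrability travels with the value because linearity of the integral relies on it. *)
Definition has_E f v :=
  (@gauss3 R).-integrable setT (EFin \o f) /\ \int[gauss3]_z f z = v.

Lemma has_E_integral f v : has_E f v -> \int[gauss3]_z f z = v.
Proof. by case. Qed.

Lemma eq_has_E f g v : f =1 g -> has_E f v -> has_E g v.
Proof. by move=> /funext ->. Qed.

Lemma has_E0 : has_E (fun=> 0) 0.
Proof.
split; first exact: integrable0.
by rewrite /Rintegral integral0.
Qed.

Lemma has_ED f g v w : has_E f v -> has_E g w ->
  has_E (fun z => f z + g z) (v + w).
Proof.
move=> [If <-] [Ig <-]; split; last by rewrite RintegralD.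
by rewrite (_ : _ \o _ = (EFin \o f) \+ (EFin \o g))%E//; exact: integrableD.
Qed.

Lemma has_EZ c f v : has_E f v -> has_E (fun z => c * f z) (c * v).
Proof.
move=> [If <-]; split; last by rewrite RintegralZl.
rewrite (_ : _ \o _ = (fun z => c%:E * (EFin \o f) z))%E//.
exact: integrableZl.
Qed.

Lemma has_E_sum (I : Type) (r : seq I) (f : I -> pureq R -> R) (v : I -> R) :
  (forall i, has_E (f i) (v i)) ->
  has_E (fun z => \sum_(i <- r) f i z) (\sum_(i <- r) v i).
Proof.
move=> h; elim: r => [|i r IH].
  by rewrite big_nil; apply: eq_has_E has_E0 => z; rewrite big_nil.
by rewrite big_cons; apply: eq_has_E (has_ED (h i) IH) => z; rewrite big_cons.
Qed.

(** The density is a product of three one-dimensional Gaussians, so Fubini, applied twice, separates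
    the coordinates. *)
Lemma has_E_monomial a b c :
  has_E (fun z => z.1.1 ^+ a * z.1.2 ^+ b * z.2 ^+ c)
    (moment a * moment b * moment c)%:R.
Proof.
pose F k (x : measurableTypeR R) : R := x ^+ k * gauss1 x.
have I1 k : lebesgue_measure.-integrable setT (EFin \o F k) :=
  integrable_moment k.
pose F2 (y : (measurableTypeR R * measurableTypeR R)%type) := F a y.1 * F b y.2.
pose leb2 := sigma_finite_prod lebesgue_measure (@lebesgue_measure R).
have I2 : leb2.-integrable setT (EFin \o F2) := integrable_prod (I1 a) (I1 b).
have I3 := @integrable_prod _ _ _ _ _ leb2 lebesgue_measure F2 (F c) I2 (I1 c).
have mf : measurable_fun [set: pureq R]
    (fun z : pureq R => z.1.1 ^+ a * z.1.2 ^+ b * z.2 ^+ c).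
  apply: measurable_funM; [apply: measurable_funM|]; apply: measurable_funX.
  - exact: (measurableT_comp measurable_fst measurable_fst).
  - exact: (measurableT_comp measurable_snd measurable_fst).
  - exact: measurable_snd.
have E : (fun z : pureq R => (F a z.1.1 * F b z.1.2 * F c z.2)%:E) =
    (fun z => (z.1.1 ^+ a * z.1.2 ^+ b * z.2 ^+ c * gauss3_pdf z)%:E).
  by apply/funext => z; rewrite gauss3_pdfE /F; congr EFin; ring.
have := I3; rewrite E => I4.
have [I5 E5] := @integral_density _ _ _ lebesgue3 gauss3 _ gauss3_pdf_ge0
  measurable_gauss3_pdf (fun A _ => erefl) _ mf I4.
split; first exact: I5.
rewrite /Rintegral E5 -E.
rewrite (@integral_prod _ _ _ _ _ leb2 lebesgue_measure _ _ I2 (I1 c)).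
rewrite (@integral_prod _ _ _ _ _ lebesgue_measure _ _ _ (I1 a) (I1 b)).
by rewrite !integral_moment -!EFinM /= !natrM.
Qed.

(** Two binomial expansions, of (x1^2 + x2^2) + x3^2 and then of x1^2 + x2^2; [j] is the exponent of
    x3^2 and [i] that of x2^2. *)
Lemma has_E_sqnorm3_monomial m a b c :
  has_E (fun z => sqnorm3 z ^+ m * (z.1.1 ^+ a * z.1.2 ^+ b * z.2 ^+ c))
   (\sum_(j < m.+1) 'C(m, j) * (\sum_(i < (m - j).+1) 'C(m - j, i) *
     (moment ((m - j - i).*2 + a) * moment (i.*2 + b))) *
      moment (j.*2 + c))%N%:R.
Proof.
pose f (j : 'I_m.+1) (i : 'I_(m - j).+1) z : R :=
  ('C(m, j) * 'C(m - j, i))%:R *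
  (z.1.1 ^+ ((m - j - i).*2 + a) * z.1.2 ^+ (i.*2 + b) * z.2 ^+ (j.*2 + c)).
apply: (@eq_has_E (fun z => \sum_j \sum_i f j i z)).
  move=> z; rewrite /sqnorm3 exprDn mulr_suml; apply: eq_bigr => j _.
  rewrite -[X in X * _]mulr_natl exprDn mulr_suml mulr_sumr mulr_suml.
  apply: eq_bigr => i _; rewrite /f -!exprM !mul2n !exprD natrM -mulr_natl.
  by ring.
rewrite natr_sum; apply: has_E_sum => j.
rewrite mulnAC big_distrr natr_sum; apply: has_E_sum => i /=.
rewrite (_ : _ * _ = 'C(m, j) * 'C(m - j, i) * (moment ((m - j - i).*2 + a) *
  moment (i.*2 + b) * moment (j.*2 + c)))%N; last by ring.
by rewrite natrM; apply/has_EZ/has_E_monomial.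
Qed.

(** Two uses of the Vandermonde identity, with 1 + 1 = 2 and 2 + 1 = 3, collapse the double sum:
    these are the moments of the chi-squared law with three degrees of freedom. *)
Lemma has_E_sqnorm3 m : has_E (fun z => sqnorm3 z ^+ m) (rising2 3 m)%:R.
Proof.
have := has_E_sqnorm3_monomial m 0 0 0.
rewrite (_ : (\sum_(j < _) _)%N = rising2 3 m).
  by apply: eq_has_E => z; rewrite !expr0 !mulr1.
rewrite -(@rising2_Vandermonde 2 1); apply: eq_bigr => j _.
rewrite -mulnA addn0 moment_even; congr (_ * (_ * _))%N.
rewrite -(@rising2_Vandermonde 1 1); apply: eq_bigr => i _.
by rewrite !addn0 !moment_even.
Qed.

(** The factors x_i^2 preserve the parity of each exponent, so every term contains an odd
    one-dimensional moment. *)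
Lemma has_E_sqnorm3_odd m a b c : odd a || odd b || odd c ->
  has_E (fun z => sqnorm3 z ^+ m * (z.1.1 ^+ a * z.1.2 ^+ b * z.2 ^+ c)) 0.
Proof.
move=> abc; have := has_E_sqnorm3_monomial m a b c.
have mo k : odd k -> moment k = 0%N.
  by move=> ok; rewrite -(odd_double_half k) ok moment_odd.
rewrite big1// => j _; case/orP: abc => [abc|oc]; last first.
  by rewrite (mo (_ + c)%N) ?muln0// oddD odd_double.
rewrite big1 ?muln0// => i _; case/orP: abc => [oa|ob].
  by rewrite (mo (_ + a)%N) ?muln0// oddD odd_double.
by rewrite (mo (_ + b)%N) ?muln0// oddD odd_double.
Qed.

End GaussianExpectation.

(** * The Dunkl operator acting on the moment sequence *)

Definition dunkl_coef k : nat := if odd k then (k + 2)%N else k.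

(** The expectation of z^k ([has_qE_pureX]), kept in [int] so that the recurrences are purely
    arithmetic. *)
Definition pure_moment k : int :=
  if odd k then 0 else (-1) ^+ k./2 * (rising2 3 k./2)%:Z.

Arguments pure_moment : simpl never.

(** Adjointness of multiplication by x and -D, tested on x^(k+1): for even [k], [dunkl_coef k.+1] is
    k+3; for odd [k] both sides vanish. *)
Lemma pure_momentSS k : pure_moment k.+2 = - (k + 3)%:Z * pure_moment k.
Proof.
rewrite /pure_moment /= negbK; case: ifPn => ok; first by rewrite mulr0.
rewrite exprS rising2S (even_halfK ok) [(3 + k)%N]addnC PoszM.
by ring.
Qed.

(* [dunkl_moment n k] is the value of the moment functional on [(-D)^n x^k], where
   the Dunkl operator [D x^k = dunkl_coef k * x^(k-1)] is adjoint to the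
   multiplication by [x] up to sign. *)
Fixpoint dunkl_moment n k : int :=
  match n, k with
  | 0, _ => pure_moment k
  | _.+1, 0 => 0
  | n'.+1, k'.+1 => - (dunkl_coef k)%:Z * dunkl_moment n' k'
  end.

Lemma dunkl_moment_odd n k : odd (n + k) -> dunkl_moment n k = 0.
Proof.
elim: n k => [|n IH] k; first by rewrite add0n /= /pure_moment => ->.
by case: k => [//|k]; rewrite addSn addnS /= negbK => /IH ->; rewrite mulr0.
Qed.

Lemma dunkl_moment_small n k : (k < n)%N -> dunkl_moment n k = 0.
Proof. by elim: n k => [|n IH] [|k] //= /IH ->; rewrite mulr0. Qed.

(** This is the recurrence of [hermiteq] read on moments, because
    [- dunkl_coef k.+1 * dunkl_moment n k] is [dunkl_moment n.+1 k.+1]. *)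
Lemma dunkl_momentSS n k : dunkl_moment n.+2 k =
  ((dunkl_coef n.+1)%:Z - (dunkl_coef k.+1)%:Z) * dunkl_moment n k.
Proof.
elim: n k => [|n IH] [|k].
- by rewrite /= subrr mul0r.
- case: k => [|k]; first by rewrite /= mulr0 /pure_moment /= mulr0.
  rewrite [LHS]/= [dunkl_moment 0 _]/= pure_momentSS /dunkl_coef /=.
  rewrite negbK; case: ifPn => ok; last by rewrite !PoszD; ring.
  by rewrite /pure_moment ok !mulr0.
- by rewrite /= mulr0.
(* For opposite parities both sides vanish. For equal parities a difference of two [dunkl_coef] is
   the difference of their indices, hence invariant under a common shift. *)
- have [ok|ok] := boolP (odd (n + k)).
    by rewrite !dunkl_moment_odd ?mulr0// !addSn ?addnS /= ?negbK.
  rewrite -[LHS]/(- (dunkl_coef k.+1)%:Z * dunkl_moment n.+2 k) IH.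
  rewrite -[dunkl_moment n.+1 _]/(- (dunkl_coef k.+1)%:Z * dunkl_moment n k).
  rewrite mulrCA; congr (_ * (_ * _)).
  move: ok; rewrite oddD /dunkl_coef /=.
  by case: (odd n); case: (odd k) => //= _; rewrite ?PoszD; ring.
Qed.

Definition hnorm n : nat := if odd n then (n`! * (n + 2))%N else n.+1`!.

(** The ratio is (n+1)! (n+3) / (n+1)! = n+3 for even [n], and (n+2)! / (n! (n+2)) = n+1 for odd
    [n]. *)
Lemma hnormS n : hnorm n.+1 = (dunkl_coef n.+1 * hnorm n)%N.
Proof.
by rewrite /hnorm /dunkl_coef /=; case: (odd n) => /=; rewrite !factS; ring.
Qed.

Lemma hnorm_gt0 n : (0 < hnorm n)%N.
Proof. by rewrite /hnorm; case: ifP => _; rewrite ?muln_gt0 fact_gt0 ?addn2. Qed.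

Lemma dunkl_moment_diag n : (-1) ^+ n * dunkl_moment n n = (hnorm n)%:Z.
Proof.
elim: n => [|n IH]; first by rewrite expr0 mul1r.
by rewrite hnormS PoszM -IH exprS /=; ring.
Qed.

(** * Expectations of quaternion-valued functions *)

Section QuaternionExpectation.
Context {R : realType}.
Implicit Types (u w : pureq R -> quat R) (v c : quat R) (z : pureq R).

Lemma conjqD (x y : quat R) : conjq (x + y) = conjq x + conjq y.
Proof. by case: x y => [????] [????]; congr Quat; rewrite /= opprD. Qed.

Lemma conjqM (x y : quat R) : conjq (x * y) = conjq y * conjq x.
Proof. by case: x y => [????] [????]; congr Quat => /=; ring. Qed.

Lemma conjq0 : conjq (0 : quat R) = 0.
Proof. by congr Quat; rewrite /= oppr0. Qed.

Lemma conjq1 : conjq (1 : quat R) = 1.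
Proof. by congr Quat; rewrite /= oppr0. Qed.

Lemma conjq_sum (I : Type) (r : seq I) (F : I -> quat R) :
  conjq (\sum_(i <- r) F i) = \sum_(i <- r) conjq (F i).
Proof. exact: (big_morph _ conjqD conjq0). Qed.

Lemma conjq_pureX z n :
  conjq (quat_of_pure z ^+ n) = (-1) ^+ n * quat_of_pure z ^+ n.
Proof.
have cz : conjq (quat_of_pure z) = - quat_of_pure z.
  by congr Quat; rewrite /= oppr0.
rewrite -exprNn; elim: n => [|n IH]; first by rewrite !expr0 conjq1.
by rewrite exprS conjqM IH cz -exprSr.
Qed.

Lemma quat_natr n : n%:R = Quat n%:R 0 0 0 :> quat R.
Proof.
by elim: n => [//|n IH]; rewrite !mulrS IH; congr Quat => /=; rewrite add0r.
Qed.

Lemma quat_intr (m : int) : m%:~R = Quat m%:~R 0 0 0 :> quat R.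
Proof.
case: m => n; first by rewrite -!pmulrn quat_natr.
by rewrite NegzE !mulrNz -!pmulrn quat_natr; congr Quat; rewrite /= oppr0.
Qed.

Lemma pureX_even z m : quat_of_pure z ^+ m.*2 = Quat ((- sqnorm3 z) ^+ m) 0 0 0.
Proof.
have z2 : quat_of_pure z ^+ 2 = Quat (- sqnorm3 z) 0 0 0.
  by rewrite expr2 /sqnorm3; congr Quat => /=; ring.
rewrite -mul2n exprM z2; elim: m => [//|m IH].
by rewrite !exprS IH; congr Quat => /=; ring.
Qed.

Lemma pureX_odd z m : quat_of_pure z ^+ m.*2.+1 =
  Quat 0 ((- sqnorm3 z) ^+ m * z.1.1) ((- sqnorm3 z) ^+ m * z.1.2)
    ((- sqnorm3 z) ^+ m * z.2).
Proof. by rewrite exprSr pureX_even; congr Quat => /=; ring. Qed.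

Definition has_qE u v := [/\ has_E (fun z => qre (u z)) (qre v),
  has_E (fun z => qi (u z)) (qi v), has_E (fun z => qj (u z)) (qj v) &
  has_E (fun z => qk (u z)) (qk v)].

Lemma has_qE_qintegral u v : has_qE u v -> qintegral u = v.
Proof.
by case: v => a b c d [Ea Eb Ec Ed]; congr Quat; apply: has_E_integral.
Qed.

Lemma has_qE_unique u v v' : has_qE u v -> has_qE u v' -> v = v'.
Proof. by move=> /has_qE_qintegral <- /has_qE_qintegral. Qed.

Lemma eq_has_qE u w v : u =1 w -> has_qE u v -> has_qE w v.
Proof. by move=> /funext ->. Qed.

Lemma has_qE0 : has_qE (fun=> 0) 0.
Proof. by split; exact: has_E0. Qed.

Lemma has_qED u w v v' : has_qE u v -> has_qE w v' ->
  has_qE (fun z => u z + w z) (v + v').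
Proof. by move=> [????] [????]; split; apply: has_ED. Qed.

(** Each component of a product with a constant quaternion, on either side, has this shape. *)
Let has_E_lin4 (a b c d : R) u v :
  has_qE u v -> has_E
    (fun z => a * qre (u z) + b * qi (u z) + c * qj (u z) + d * qk (u z))
    (a * qre v + b * qi v + c * qj v + d * qk v).
Proof. by move=> [????]; do !apply: has_ED; apply: has_EZ. Qed.

Let eq_has_E2 (f g : pureq R -> R) a b :
  f =1 g -> a = b -> has_E f a -> has_E g b.
Proof. by move=> /funext -> ->. Qed.

Lemma has_qEMl c u v : has_qE u v -> has_qE (fun z => c * u z) (c * v).
Proof.
case: c => c0 c1 c2 c3 h; split.
- by apply: eq_has_E2 (has_E_lin4 c0 (- c1) (- c2) (- c3) h) => [z|] /=; ring.
- by apply: eq_has_E2 (has_E_lin4 c1 c0 (- c3) c2 h) => [z|] /=; ring.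
- by apply: eq_has_E2 (has_E_lin4 c2 c3 c0 (- c1) h) => [z|] /=; ring.
- by apply: eq_has_E2 (has_E_lin4 c3 (- c2) c1 c0 h) => [z|] /=; ring.
Qed.

Lemma has_qEMr c u v : has_qE u v -> has_qE (fun z => u z * c) (v * c).
Proof.
case: c => c0 c1 c2 c3 h; split.
- by apply: eq_has_E2 (has_E_lin4 c0 (- c1) (- c2) (- c3) h) => [z|] /=; ring.
- by apply: eq_has_E2 (has_E_lin4 c1 c0 c3 (- c2) h) => [z|] /=; ring.
- by apply: eq_has_E2 (has_E_lin4 c2 (- c3) c0 c1 h) => [z|] /=; ring.
- by apply: eq_has_E2 (has_E_lin4 c3 c2 (- c1) c0 h) => [z|] /=; ring.
Qed.

Lemma has_qE_sum (I : Type) (r : seq I) (F : I -> pureq R -> quat R)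
    (V : I -> quat R) : (forall i, has_qE (F i) (V i)) ->
  has_qE (fun z => \sum_(i <- r) F i z) (\sum_(i <- r) V i).
Proof.
move=> h; elim: r => [|i r IH].
  by rewrite big_nil; apply: eq_has_qE has_qE0 => z; rewrite big_nil.
by rewrite big_cons; apply: eq_has_qE (has_qED (h i) IH) => z; rewrite big_cons.
Qed.

(** Even powers are the reals (-|z|^2)^m; odd powers are pure, and each component is odd in one
    coordinate, so it averages to 0. *)
Lemma has_qE_pureX k :
  has_qE (fun z => quat_of_pure z ^+ k) (pure_moment k)%:~R.
Proof.
have h0 : has_E (fun=> 0 : R) 0 := has_E0.
have hodd (m a b c : nat) : odd a || odd b || odd c ->
    has_E (fun z => (- sqnorm3 z) ^+ m * (z.1.1 ^+ a * z.1.2 ^+ b * z.2 ^+ c)) 0.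
  move=> abc; have := has_EZ ((-1) ^+ m) (@has_E_sqnorm3_odd R m a b c abc).
  by rewrite mulr0; apply: eq_has_E => z; rewrite mulrA -exprNn.
rewrite quat_intr -{1}(odd_double_half k) /pure_moment.
case: (odd k); rewrite /= ?add1n ?add0n.
  split => /=.
  - by apply: eq_has_E h0 => z; rewrite pureX_odd.
  - apply: eq_has_E (hodd k./2 1 0 0 isT)%N => z.
    by rewrite pureX_odd /= expr1 !expr0 !mulr1.
  - apply: eq_has_E (hodd k./2 0 1 0 isT)%N => z.
    by rewrite pureX_odd /= expr1 !expr0 mul1r mulr1.
  - apply: eq_has_E (hodd k./2 0 0 1 isT)%N => z.
    by rewrite pureX_odd /= expr1 !expr0 !mul1r.
split => /=; try by apply: eq_has_E h0 => z; rewrite pureX_even.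
rewrite intrM rmorphXn rmorphN1 /=.
apply: eq_has_E (has_EZ _ (has_E_sqnorm3 _)) => z.
by rewrite pureX_even -exprNn.
Qed.

(** The polynomials Q_n. Their coefficients are natural numbers, hence central, so the side on which
    they stand is immaterial. *)
Fixpoint hermiteq n (x : quat R) : quat R :=
  match n with
  | 0 => 1
  | 1 => x
  | (n''.+1 as n').+1 => x * hermiteq n' x + hermiteq n'' x *+ dunkl_coef n'
  end.

Lemma hermiteqSS n x : hermiteq n.+2 x =
  x * hermiteq n.+1 x + (dunkl_coef n.+1)%:R * hermiteq n x.
Proof. by rewrite mulr_natl. Qed.

(** Strong induction along the recurrence of [hermiteq], matched with [dunkl_momentSS]; the case
    [n = 1] is [pure_momentSS]. *)
Lemma has_qE_pureX_hermiteq n k :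
  has_qE (fun z => quat_of_pure z ^+ k * hermiteq n (quat_of_pure z))
    (dunkl_moment n k)%:~R.
Proof.
have [m nm] := ubnP n; elim: m n nm k => // m IH [|[|n]] nm k.
- by apply: eq_has_qE (has_qE_pureX k) => z; rewrite /= mulr1.
- rewrite (_ : dunkl_moment 1 k = pure_moment k.+1).
    by apply: eq_has_qE (has_qE_pureX k.+1) => z; rewrite exprSr.
  case: k => [//|k]; rewrite pure_momentSS /= /dunkl_coef /=.
  case: ifPn => [_|]; first by rewrite addn2 addn3.
  by rewrite negbK /pure_moment => ->; rewrite !mulr0.
rewrite (_ : dunkl_moment n.+2 k =
    dunkl_moment n.+1 k.+1 + (dunkl_coef n.+1)%:Z * dunkl_moment n k); last first.
  by rewrite dunkl_momentSS [dunkl_moment n.+1 _]/= mulrBl mulNr addrC.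
rewrite intrD intrM -pmulrn.
have h1 := IH n.+1 nm k.+1.
have h0 := IH n (ltn_trans (ltnSn n) nm) k.
apply: eq_has_qE (has_qED h1 (has_qEMl _ h0)) => z.
by rewrite hermiteqSS mulrDr exprSr -mulrA !mulrA -[_%:R * _]commr_nat.
Qed.

End QuaternionExpectation.

(** * Norms and recurrence coefficients of the orthogonal system *)

Section OrthogonalPolynomials.
Context {R : realType} (P : nat -> pureq R -> quat R).
Hypothesis hP : monic_orthogonal P.
Implicit Types (z : pureq R) (n k j : nat).

Local Notation X := quat_of_pure.
Local Notation dotP n w := (has_qE (fun z => conjq (P n z) * w z)).

Lemma qdotP n k v : dotP n (P k) v -> qdot (P n) (P k) = v.
Proof. exact: has_qE_qintegral. Qed.

(** Expanding the conjugate of [P n] reduces everything to [dunkl_moment]. For [j = 0] this supplies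
    integrability against z^k; for [k = 0], [j = n] only the leading term survives, since D^n kills
    lower degrees. *)
Lemma dotP_pureX_hermiteq n k j : exists v, [/\
  dotP n (fun z => X z ^+ k * hermiteq j (X z)) v &
  (k + j = n)%N -> k = 0%N -> v = (hnorm n)%:R].
Proof.
have [a Pa] := hP.1 n.
exists ((-1) ^+ n * (dunkl_moment j (n + k))%:~R +
  \sum_(i < n) conjq (a i) * ((-1) ^+ i * (dunkl_moment j (i + k))%:~R)).
split.
  apply: (@eq_has_qE _ (fun z => (-1) ^+ n * (X z ^+ (n + k) * hermiteq j (X z)) +
    \sum_(i < n) conjq (a i) *
      ((-1) ^+ i * (X z ^+ (i + k) * hermiteq j (X z))))).
    move=> z; rewrite Pa conjqD conjq_sum mulrDl mulr_suml conjq_pureX.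
    rewrite exprD !mulrA; congr (_ + _); apply: eq_bigr => i _.
    by rewrite conjqM conjq_pureX exprD !mulrA.
  apply: has_qED; first exact/has_qEMl/has_qE_pureX_hermiteq.
  by apply: has_qE_sum => i; do 2!apply: has_qEMl; exact: has_qE_pureX_hermiteq.
move=> kjn k0; subst k; rewrite add0n in kjn; subst j.
rewrite big1 ?addr0 => [|i _]; last first.
  by rewrite addn0 dunkl_moment_small// mulr0z !mulr0.
by rewrite addn0 -[RHS]/((hnorm n)%:~R) -dunkl_moment_diag intrM rmorphXn rmorphN1.
Qed.

(** Triangularity: [P k] is z^k plus lower powers, which [P n] annihilates by strong induction, so
    orthogonality to [P k] forces the value at z^k to be 0. *)
Lemma dotP_pureX_lt n k : (k < n)%N -> dotP n (fun z => X z ^+ k) 0.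
Proof.
elim/ltn_ind: k => k IH kn.
have [v [hv _]] := dotP_pureX_hermiteq n k 0.
have {}hv : dotP n (fun z => X z ^+ k) v.
  by apply: eq_has_qE hv => z; rewrite /= mulr1.
have [a Pa] := hP.1 k.
(* The terms [0 * a i] stay unsimplified to match right multiplication of the induction hypothesis
   by [a i]. *)
have h : dotP n (P k) (v + \sum_(i < k) 0 * a i).
  apply: (@eq_has_qE _ (fun z => conjq (P n z) * X z ^+ k +
     \sum_(i < k) conjq (P n z) * X z ^+ i * a i)).
    move=> z; rewrite Pa mulrDr mulr_sumr; congr (_ + _).
    by apply: eq_bigr => i _; rewrite mulrA.
  apply: has_qED => //; apply: has_qE_sum => i.
  by apply: has_qEMr; apply: IH; rewrite ?(ltn_trans _ kn).
have := qdotP h; rewrite (hP.2 n k) ?gtn_eqF// big1 ?addr0 => [v0|i _].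
  by rewrite -v0 in hv.
by rewrite mul0r.
Qed.

(* Modulo lower degree terms, which [P n] annihilates, [hermiteq j x] is [x ^+ j]. *)
Lemma dotP_hermiteq n k j v : (k + j <= n)%N ->
  dotP n (fun z => X z ^+ (k + j)) v ->
  dotP n (fun z => X z ^+ k * hermiteq j (X z)) v.
Proof.
have [m jm] := ubnP j; elim: m j jm k v => // m IH [|[|j]] jm k v kjn.
- by rewrite addn0; apply: eq_has_qE => z; rewrite /= mulr1.
- by rewrite addn1; apply: eq_has_qE => z; rewrite exprSr.
move=> hv.
have h1 : dotP n (fun z => X z ^+ k.+1 * hermiteq j.+1 (X z)) v.
  by apply: IH; rewrite // addSn -addnS.
have h0 : dotP n (fun z => X z ^+ k * hermiteq j (X z)) 0.
  apply: IH; first exact: ltn_trans (ltnSn j) jm.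
    by rewrite (leq_trans _ kjn)// leq_add2l ltnW.
  by apply: dotP_pureX_lt; rewrite (leq_trans _ kjn)// ltn_add2l.
have := has_qED h1 (has_qEMl (dunkl_coef j.+1)%:R h0).
rewrite mulr0 addr0; apply: eq_has_qE => z.
rewrite hermiteqSS !mulrDr exprSr !mulrA; congr (_ + _).
by rewrite [_ * _%:R in RHS]commr_nat !mulrA.
Qed.

Lemma hcoefE n : hcoef P n = (hnorm n)%:R.
Proof.
have [v [hv _]] := dotP_pureX_hermiteq n n 0.
have {}hv : dotP n (fun z => X z ^+ n) v.
  by apply: eq_has_qE hv => z; rewrite /= mulr1.
(* The scalar product with Q_n is evaluated twice: it equals [v] because Q_n is z^n modulo lower
   degrees, and [hnorm n] by the Dunkl computation. *)
have [v' [hv' /(_ erefl erefl) v'E]] := dotP_pureX_hermiteq n 0 n.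
have vE : v = (hnorm n)%:R.
  by rewrite -v'E; exact: has_qE_unique (@dotP_hermiteq n 0 n v (leqnn n) hv) hv'.
have [a Pa] := hP.1 n.
rewrite -vE -[RHS]addr0; apply: qdotP.
rewrite (_ : 0 = \sum_(i < n) 0 * a i); last first.
  by rewrite big1// => i _; rewrite mul0r.
apply: (@eq_has_qE _ (fun z => conjq (P n z) * X z ^+ n +
     \sum_(i < n) conjq (P n z) * X z ^+ i * a i)).
  move=> z; rewrite [in X in _ = _ * X]Pa mulrDr mulr_sumr; congr (_ + _).
  by apply: eq_bigr => i _; rewrite mulrA.
apply: has_qED => //; apply: has_qE_sum => i.
by apply: has_qEMr; apply: dotP_pureX_lt.
Qed.

Lemma betacoefE n : betacoef P n.+1 = (dunkl_coef n.+1)%:R.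
Proof.
rewrite /betacoef !hcoefE hnormS natrM mulrK//.
(* The units of [quat R] are by definition its nonzero elements, and the squared norm of a natural
   number is its square. *)
by rewrite -[_ \is a _]/(_ != 0) -sqnormq_eq0 quat_natr /sqnormq/= expr0n/= !addr0
  sqrf_eq0 pnatr_eq0 -lt0n hnorm_gt0.
Qed.

End OrthogonalPolynomials.

Theorem mainTheorem4 (R : realType) (P : nat -> pureq R -> quat R)
    (hP : monic_orthogonal P) :
  (forall n : nat,
     hcoef P n = (if odd n then n`! * (n + 2) else n.+1`!)%N%:R) /\
  (forall n : nat, (1 <= n)%N ->
     betacoef P n = (if odd n then n + 2 else n)%N%:R).
Proof.
split=> [n|[//|n] _]; first by rewrite (hcoefE hP).
by rewrite (betacoefE hP).
Qed.
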